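(* Let $S$ be a symmetric numerical semigroup with embedding dimension three, and let $\delta_1,\delta_2$ be the integers associated to $S$ as described in the context, with $\delta_1,\delta_2$ positive. Then $$\Delta(S)=\mathrm{Euc}(\delta_1,\delta_2)\setminus\{0\}.$$
   Context: $\mathbb N$ denotes the non-negative integers. $S=\langle n_1,n_2,n_3\rangle=\{a_1n_1+a_2n_2+a_3n_3\mid a_i\in\mathbb N\}$ is minimally generated by $\{n_1,n_2,n_3\}$ with $\gcd(n_1,n_2,n_3)=1$. $S$ is symmetric if $x\in\mathbb Z\setminus S$ implies $\mathrm F(S)-x\in S$, where $\mathrm F(S)=\max(\mathbb Z\setminus S)$. For $s\in S$: $\mathsf Z(s)=\{(z_1,z_2,z_3)\in\mathbb N^3\mid z_1n_1+z_2n_2+z_3n_3=s\}$; for $\mathbf v\in\mathbb Z^3$, $\ell(\mathbf v)=v_1+v_2+v_3$. If $\{\ell(\mathbf z)\mid\mathbf z\in\mathsf Z(s)\}=\{l_1<\dots<l_k\}$, then $\Delta(s)=\{l_i-l_{i-1}\mid 2\le i\le k\}$, and $\Delta(S)=\bigcup_{s\in S}\Delta(s)$. $M_S=\{\mathbf v\in\mathbb Z^3\mid v_1n_1+v_2n_2+v_3n_3=0\}$. An element $s\in S$ is a Betti element if the graph with vertex set $\mathsf Z(s)$, in which $\mathbf z,\mathbf z'$ are adjacent iff $\mathbf z\cdot\mathbf z'\ne 0$, is not connected. A symmetric $S$ of embedding dimension three has one or two Betti elements. Choice of a basis $\{\mathbf v_1,\mathbf v_2\}$ of $M_S$ (the generators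 being suitably ordered): (1) If $S$ has one Betti element, then $(n_1,n_2,n_3)=(s_2s_3,s_1s_3,s_1s_2)$ with pairwise coprime positive integers $s_1>s_2>s_3$; set $\mathbf v_1=(s_1,-s_2,0)$, $\mathbf v_2=(0,s_2,-s_3)$. (2) If $S$ has two Betti elements, then $(n_1,n_2,n_3)=(am_1,am_2,bm_1+cm_2)$ with $2\le m_1<m_2$ coprime, $a\ge2$, $b,c\in\mathbb N$, $b+c\ge2$, $\gcd(a,bm_1+cm_2)=1$; set $\mathbf v_1=(m_2,-m_1,0)$ and $\mathbf v_2=(b+\lambda m_2,c-\lambda m_1,-a)$, where $\lambda\in\{-\lfloor b/m_2\rfloor,\dots,\lfloor c/m_1\rfloor\}$ is chosen so that $|\ell(\mathbf v_2)|$ is minimal. Put $\delta_1=\ell(\mathbf v_1)$ and $\delta_2=|\ell(\mathbf v_2)|$. Euclid's set: for positive integers $\delta_1,\delta_2$ let $\eta_1=\max\{\delta_1,\delta_2\}$, $\eta_2=\min\{\delta_1,\delta_2\}$, and $\eta_{j+2}=\eta_j\bmod\eta_{j+1}$ for $j\ge1$ as long as $\eta_{j+1}>0$. For indices with $\eta_{j+1}>0$, define $\mathrm D(\eta_1,\eta_2)=\{\eta_1,\eta_1-\eta_2,\dots,\eta_3\}$, $\mathrm D(\eta_2,\eta_3)=\{\eta_2,\eta_2-\eta_3,\dots,\eta_4\}$, and for $j\ge3$, $\mathrm D(\eta_j,\eta_{j+1})=\{\eta_j-\eta_{j+1},\eta_j-2\eta_{j+1},\dots,\eta_{j+2}\}$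 (arithmetic progressions of step $\eta_{j+1}$ ending at $\eta_j\bmod\eta_{j+1}=\eta_{j+2}$). Then $\mathrm{Euc}(\delta_1,\delta_2)=\bigcup_{j\ge1,\ \eta_{j+1}>0}\mathrm D(\eta_j,\eta_{j+1})$.
   Formalization: In case (2), ''suitably ordered'' is made precise by requiring a·m1·m2 − a·n3 not in S; without it the claim fails, e.g. (6,26,15) gives deltas 10, 3 but 10 is not in Δ(S). Every S with two Betti elements has such an order. *)

(* Defs.v *)
From mathcomp Require Import all_boot all_order all_algebra.
From mathcomp Require Import boolp classical_sets functions cardinality.
Set Implicit Arguments.
Unset Strict Implicit.
Unset Printing Implicit Defensive.
Import Order.TTheory GRing.Theory Num.Theory.
Local Open Scope classical_set_scope.

Definition vec3 (R : Type) (x y z : R) : 'rV[R]_3 :=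
  \row_(i < 3) nth x [:: x; y; z] i.

Definition dot (R : pzSemiRingType) (u v : 'rV[R]_3) : R :=
  (\sum_(i < 3) u ord0 i * v ord0 i)%R.

Definition len (R : pzSemiRingType) (v : 'rV[R]_3) : R :=
  (\sum_(i < 3) v ord0 i)%R.

(* A triple [n] is an ordered generating system: it carries the order of the
   generators as well as the semigroup. *)
Definition subsemigroup (n : 'rV[nat]_3) (P : pred 'I_3) : set nat :=
  [set s | exists z : 'rV[nat]_3,
     (forall i, ~~ P i -> z ord0 i = 0%N) /\ dot z n = s].

Definition semigroup (n : 'rV[nat]_3) : set nat :=
  [set s | exists z : 'rV[nat]_3, dot z n = s].

Definition minimally_generated (n : 'rV[nat]_3) : Prop :=
  forall P : pred 'I_3, subsemigroup n P = semigroup n -> forall i, P i.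

Definition symmetric_semigroup (S : set nat) : Prop :=
  exists F : int,
    [/\ ~ (Posz @` S) F,
        forall x : int, ~ (Posz @` S) x -> (x <= F)%R
      & forall x : int, ~ (Posz @` S) x -> (Posz @` S) (F - x)%R].

Definition factorizations (n : 'rV[nat]_3) (s : nat) : set 'rV[nat]_3 :=
  [set z | dot z n = s].

Definition lengths (n : 'rV[nat]_3) (s : nat) : set nat :=
  [set len z | z in factorizations n s].

Definition delta_of (n : 'rV[nat]_3) (s : nat) : set nat :=
  [set d | exists l l' : nat,
     [/\ lengths n s l, lengths n s l', (l < l')%N,
         forall m, lengths n s m -> ~~ (l < m < l')%N
       & d = (l' - l)%N]].

Definition delta_set (n : 'rV[nat]_3) : set nat :=
  \bigcup_(s in semigroup n) delta_of n s.

Definition fact_adj (n : 'rV[nat]_3) (s : nat) : rel 'rV[nat]_3 :=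
  fun z z' => [&& dot z n == s, dot z' n == s & dot z z' != 0%N].

Definition fact_connected (n : 'rV[nat]_3) (s : nat) : Prop :=
  forall z z', factorizations n s z -> factorizations n s z' ->
    exists2 p, path (fact_adj n s) z p & last z p = z'.

Definition betti (n : 'rV[nat]_3) : set nat :=
  [set s | semigroup n s /\ ~ fact_connected n s].

Definition basis_one_betti (n : 'rV[nat]_3) (v1 v2 : 'rV[int]_3) : Prop :=
  (betti n #= `I_1)%card /\
  exists s1 s2 s3 : nat,
    [/\ (0 < s3 < s2)%N /\ (s2 < s1)%N,
        [/\ coprime s1 s2, coprime s1 s3 & coprime s2 s3],
        n = vec3 (s2 * s3)%N (s1 * s3)%N (s1 * s2)%N,
        v1 = (vec3 s1%:Z (- s2%:Z) 0)%R
      & v2 = (@vec3 int 0 s2%:Z (- s3%:Z))%R].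

Definition second_vector (m1 m2 a b c : nat) (lam : int) : 'rV[int]_3 :=
  @vec3 int (b%:Z + lam * m2%:Z)%R (c%:Z - lam * m1%:Z)%R (- a%:Z)%R.

Definition lambda_range (m1 m2 b c : nat) : set int :=
  [set lam : int | (- (b %/ m2)%N%:Z <= lam <= (c %/ m1)%N%:Z)%R].

(* The Betti elements are a m1 m2 and a n3, where n3 = b m1 + c m2.
   When n3 is a multiple of m1 (resp. m2), the gluing of n3 with a m1
   (resp. a m2) has the same shape, with the Betti elements exchanged, so a
   choice is left in the order of the generators.  The suitable one is that in
   which v1, unlike v2, admits no modification: a m1 m2 - a n3 is not in the
   semigroup, i.e. (m2, 0, 0) and (0, m1, 0) are the only factorizations of
   a m1 m2.  With the other order the pair (delta_1, delta_2) is wrong: for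
   <6, 15, 26>, the order (6, 15, 26) gives {3, 4}, whereas (6, 26, 15) gives
   {10, 3}, although 10 is not in the Delta set. *)
Definition suitable_order (n : 'rV[nat]_3) (m1 m2 a b c : nat) : Prop :=
  ~ exists2 s, semigroup n s & (a * m1 * m2 = a * (b * m1 + c * m2) + s)%N.

Definition basis_two_betti (n : 'rV[nat]_3) (v1 v2 : 'rV[int]_3) : Prop :=
  (betti n #= `I_2)%card /\
  exists m1 m2 a b c : nat,
    [/\ [/\ (2 <= m1 < m2)%N, coprime m1 m2, (2 <= a)%N, (2 <= b + c)%N
          & coprime a (b * m1 + c * m2)],
        n = vec3 (a * m1)%N (a * m2)%N (b * m1 + c * m2)%N,
        suitable_order n m1 m2 a b c,
        v1 = (vec3 m2%:Z (- m1%:Z) 0)%R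
      & exists lam : int,
          [/\ lambda_range m1 m2 b c lam,
              forall mu : int, lambda_range m1 m2 b c mu ->
                (`|len (second_vector m1 m2 a b c lam)|
                   <= `|len (second_vector m1 m2 a b c mu)|)%R
            & v2 = second_vector m1 m2 a b c lam]].

Definition chosen_basis (n : 'rV[nat]_3) (v1 v2 : 'rV[int]_3) : Prop :=
  basis_one_betti n v1 v2 \/ basis_two_betti n v1 v2.

(* [eta_pair d1 d2 j] is (eta_j, eta_(j+1)) for j >= 1; the value at 0 is a
   dummy.  Once eta_(j+1) = 0 the sequence has stopped and is padded with 0,
   since [x %% 0 = x]. *)
Fixpoint eta_pair (d1 d2 j : nat) : nat * nat :=
  match j with
  | 0 => (0, 0)
  | 1 => (maxn d1 d2, minn d1 d2)
  | j'.+1 => let: (x, y) := eta_pair d1 d2 j' in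
             (y, if y == 0 then 0 else x %% y)
  end%N.

Definition euc_block (j x y : nat) : set nat :=
  [set d | exists k : nat,
     ((if (j <= 2)%N then 0 else 1) <= k <= x %/ y)%N /\ d = (x - k * y)%N].

Definition euc (d1 d2 : nat) : set nat :=
  [set d | exists j : nat,
     let: (x, y) := eta_pair d1 d2 j in
     [/\ (1 <= j)%N, (0 < y)%N & euc_block j x y d]].

(* Main.v *)
Require Import Defs.
From mathcomp Require Import all_boot all_order all_algebra.
From mathcomp Require Import boolp classical_sets functions cardinality.
From mathcomp Require Import zify.
Local Open Scope classical_set_scope.
Import Order.TTheory GRing.Theory Num.Theory.

(** The Delta set is computed in the rank two lattice of the relations between
the generators, where it becomes a planar problem that the Euclidean algorithm
solves.

If two factorizations z, z' of s have consecutive lengths, subtracting their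
common part keeps the lengths consecutive.  So d is in the Delta set if and only
if some relation v has |len v| = d and no relation u >= min(v, 0) has a length
strictly between 0 and len v ([delta_set_lattice_gap]).  This form is symmetric
in the first two generators, and v may be replaced by -v.

In both cases of the choice of the basis the generators are
(a q, a p, f q + g p), and v1 = (p, -q, 0), v2 = (f, g, -a) is a basis of the
relations.  After exchanging the first two generators if needed, len v1 and
len v2 have the same sign, so that the relation y v2 - x v1 has length
y d2 - x d1 up to a global sign.  Then d is the length of such a gap v exactly
when d = |y d2 - x d1| > 0 for some x, y >= 0 such that no (x', y') in the box
[0, x] x [0, y] has y' d2 - x' d1 strictly between 0 and y d2 - x d1
([coord_gap_box], [box_gap_coord]).  The constraint u >= min(v, 0) is not a box,
but of two points of the box that are symmetric about its centre at least one
satisfies it, and strict betweenness is invariant under this symmetry.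
Conversely an admissible point outside the box is harmless: d <= d1 or d <= d2
follows from the corners (1, 0) and (0, 1) of the box, except in degenerate
positions ruled out by the minimality of |len v2| and by the order chosen for
the generators.

Finally the box gaps obey the subtractive Euclidean algorithm: for 0 < b < a
the gaps of (a, b) are a together with the gaps of (a - b, b), via the shear
(x, y) -> (x, y - x) ([box_gap_sub]).  Grouping the subtractions into divisions
gives Euclid's set ([euc_box_gap]). *)

(** * Gaps of a linear form on a box *)

Definition between0 (t s : int) : bool := ((0 < s < t) || (t < s < 0))%R.

(** The length, up to sign, of the relation y v2 - x v1 when v1 and v2 have
lengths of the same sign, with absolute values a and b. *)
Definition lin_len (a b : nat) (x y : int) : int := (y * b%:Z - x * a%:Z)%R.

Definition box_gap (a b d : nat) : Prop :=
  exists x y : nat,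
    [/\ d = `|lin_len a b x y|%N, (0 < d)%N
      & forall x' y' : nat, (x' <= x)%N -> (y' <= y)%N ->
          ~~ between0 (lin_len a b x y) (lin_len a b x' y')].

Lemma box_gap_sym a b d : box_gap a b d -> box_gap b a d.
Proof.
case=> x [y [-> d0 H]]; exists y, x; split; try by rewrite /lin_len in d0 *; lia.
by move=> x' y' hx hy; have := H y' x' hy hx; rewrite /between0 /lin_len; lia.
Qed.

Lemma box_gap_left a b : (0 < a)%N -> box_gap a b a.
Proof.
move=> a0; exists 1%N, 0%N; split=> //; first by rewrite /lin_len; lia.
by move=> [|[|//]] [|//] _ _; rewrite /between0 /lin_len; lia.
Qed.

Lemma box_gap_diag a d : (0 < a)%N -> box_gap a a d -> d = a.
Proof.
move=> a0 [x [y [-> d0 H]]].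
have [xy|xy] := leqP x y.
  have y1 : (1 <= y)%N.
    have [y0|//] := posnP y; have x0 : x = 0%N by lia.
    by move: d0; rewrite x0 y0.
  have [c yE] : exists c, y = (x + c)%N by exists (y - x)%N; lia.
  have := H 0%N 1%N isT y1; move: d0; rewrite /between0 /lin_len yE.
  by case: c {yE} => [|c]; first lia; have := leq0n (c * a)%N; lia.
have [c xE] : exists c, x = (y + c.+1)%N by exists (x - y.+1)%N; lia.
have := H 1%N 0%N (leq_ltn_trans (leq0n y) xy) isT; move: d0; rewrite /between0 /lin_len xE.
by have := leq0n (c * a)%N; lia.
Qed.

(** With t = y - x one has y b - x a = t b - x (a - b), so a box of (x, t)
embeds in the box of (x, y).  The remaining points of the latter lie below the
diagonal, where the form is at most -a, or are the mirror images of such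
points.  Likewise, if x > y then the value at (1, 0) forces the gap to be a. *)
Lemma box_gap_sub a b d : (0 < b < a)%N ->
  box_gap a b d <-> d = a \/ box_gap (a - b) b d.
Proof.
move=> /andP[b0 ab]; have a0 : (0 < a)%N by apply: leq_trans ab.
have [c cE] : exists c, a = (b + c)%N by exists (a - b)%N; lia.
have linE x y : lin_len (a - b) b x y = lin_len a b x (y + x)%R.
  by rewrite /lin_len cE addKn; lia.
split.
- case=> x [y [dE d0 H]].
  have [xy|xy] := leqP x y.
    right; exists x, (y - x)%N; split=> //.
      by rewrite linE -PoszD subnK.
    move=> x' y' hx hy; rewrite !linE -!PoszD subnK //.
    by apply: H => //; lia.
  left; have := H 1%N 0%N (leq_ltn_trans (leq0n y) xy) isT.
  by move: dE d0; rewrite /between0 /lin_len; nia.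
- case=> [->|[x [y [dE d0 H]]]]; first exact: box_gap_left.
  exists x, (y + x)%N; split=> //; first by rewrite dE linE PoszD.
  have key x' y' : (y' < x')%N -> (x' <= x)%N ->
      ~~ between0 (lin_len a b x (y + x)%N) (lin_len a b x' y').
    move=> yx hx; have := H 1%N 0%N (leq_trans (leq_ltn_trans (leq0n y') yx) hx) isT.
    by rewrite !linE PoszD /between0 /lin_len; nia.
  move=> x' y' hx hy; have [yx|xy] := ltnP y' x'; first exact: key.
  (* Otherwise the mirror image of (x', y') lies below the diagonal. *)
  have [le|lt] := leqP (y' - x') y.
    have := H x' (y' - x')%N hx le.
    by rewrite !linE -!PoszD subnK.
  have := key (x - x')%N (y + x - y')%N _ (leq_subr _ _).
  have -> : lin_len a b (x - x')%N (y + x - y')%N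
            = (lin_len a b x (y + x)%N - lin_len a b x' y')%R.
    by rewrite /lin_len -!subzn //; lia.
  by rewrite /between0; lia.
Qed.

(** One division step groups a %/ b subtractions; if the remainder r is not
zero, the last one, from (b + r, b) to (r, b), also exchanges the two numbers. *)
Lemma box_gap_block a b d : (0 < b <= a)%N ->
  box_gap a b d <->
  (exists2 k, (k <= a %/ b)%N & d = (a - k * b)%N /\ (0 < d)%N) \/
  ((0 < a %% b)%N /\ box_gap b (a %% b) d).
Proof.
move=> /andP[b0].
move: {2}(a %/ b)%N (erefl (a %/ b)%N) => q; elim: q a => [|q IH] a qE ab.
  by move: (divn_gt0 a b0); rewrite qE ab.
have dE : (a - b) %/ b = q.
  by move: qE; rewrite -{1}(subnK ab) divnDr ?dvdnn // divnn b0 addn1 => -[].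
have mE : (a - b) %% b = a %% b by rewrite -{2}(subnK ab) modnDr.
have [ba|ba] := ltnP b a; last first.
  have <- : b = a by lia.
  rewrite modnn divnn b0; split.
    move/(box_gap_diag _ _ b0) => ->; left; exists 0%N => //; lia.
  case=> [[[|[|//]] _ [dk d0]]|[//]]; last lia.
  by have -> : d = b; [lia | exact: box_gap_left].
rewrite (box_gap_sub _ _ d); last by rewrite b0.
have [bab|bab] := leqP b (a - b).
  rewrite (IH _ dE bab) dE mE qE; split.
    case=> [->|[[k kq [dk d0]]|r]]; [left; exists 0%N => //; lia | left | by right].
    by exists k.+1 => //; rewrite mulSn; lia.
  case=> [[[|k] kq [dk d0]]|r]; [by left; lia | right; left | by right; right].
  by exists k => //; move: dk; rewrite mulSn; lia.
have q0 : q = 0%N by rewrite -dE divn_small.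
rewrite qE q0 -mE modn_small //; split.
  case=> [->|/box_gap_sym H]; first by left; exists 0%N => //; lia.
  by right; split=> //; lia.
case=> [[[|[|//]] _ [dk d0]]|[_ /box_gap_sym H]]; last by right.
  by left; lia.
right; apply: box_gap_sym.
by have -> : d = (a - b)%N; [lia|]; apply: box_gap_sym; apply: box_gap_left; lia.
Qed.

(** * Euclid's set *)

Definition euclid_step (xy : nat * nat) : nat * nat :=
  (xy.2, if xy.2 == 0%N then 0%N else xy.1 %% xy.2).

Lemma eta_pairE a b j :
  eta_pair a b j.+1 = iter j euclid_step (maxn a b, minn a b).
Proof.
elim: j => //= j <-; case: j => [|j] //=.
by case: (match j with 0%N => _ | _ => _ end) => x y /=; rewrite -/eta_pair.
Qed.

Lemma iter_euclid_step_le j x y : (y <= x)%N ->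
  ((iter j euclid_step (x, y)).2 <= (iter j euclid_step (x, y)).1)%N.
Proof.
move=> yx; case: j => //= j; case: (iter j _ _) => u w /=.
by case: eqP => [->|/eqP w0] //; rewrite ltnW // ltn_pmod // lt0n.
Qed.

(** Euclid's set with every block taken in full, that is, including k = 0. *)
Definition euclid_quotients (x y d : nat) : Prop :=
  exists j k : nat, let p := iter j euclid_step (x, y) in
    [/\ (0 < p.2)%N, (k <= p.1 %/ p.2)%N & d = (p.1 - k * p.2)%N].

(** The element k = 0 that the blocks with j >= 3 leave out is eta_j, the last
element of the block j - 2. *)
Lemma eucE a b d : euc a b d <-> euclid_quotients (maxn a b) (minn a b) d.
Proof.
have ab : (minn a b <= maxn a b)%N by lia.
split.
  case=> -[|j]; first by case.
  rewrite eta_pairE => H; exists j.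
  case: (iter _ _ _) H => x y /= [_ y0 [k [/andP[_ kle] dE]]].
  by exists k.
case=> j [k]; case E: (iter j _ _) => [x y] /= [y0 kle dE].
case: (posnP k) => [k0|k0]; last first.
  exists j.+1; rewrite eta_pairE E; split=> //; exists k; split=> //.
  by rewrite kle andbT; case: ifP.
case: j E => [|[|j]] E; first by exists 1%N; rewrite eta_pairE E; split=> //; exists k.
  by exists 2%N; rewrite eta_pairE E; split=> //; exists k.
have := iter_euclid_step_le j _ _ ab; move: E => /=.
case E: (iter j _ _) => [u w] /= [xE yE] wu.
have w0 : (0 < w)%N.
  by case: posnP => // w0; move: y0; rewrite -yE w0.
exists j.+1; rewrite eta_pairE E; split=> //.
exists (u %/ w); split; first by rewrite leqnn andbT; case: ifP => // _; rewrite divn_gt0.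
rewrite dE k0 -xE gtn_eqF //.
by rewrite {2}(divn_eq u w) addKn mul0n subn0.
Qed.

Lemma euclid_quotients_rec x y d : (0 < y)%N ->
  euclid_quotients x y d <->
  (exists2 k, (k <= x %/ y)%N & d = (x - k * y)%N)
  \/ euclid_quotients y (x %% y) d.
Proof.
move=> y0; have stepE : euclid_step (x, y) = (y, x %% y).
  by rewrite /euclid_step /= gtn_eqF.
split.
  case=> -[|j] [k H]; first by left; exists k; case: H.
  by right; exists j, k; rewrite -stepE -iterSr.
case=> [[k kq dE]|[j [k H]]]; first by exists 0%N, k.
by exists j.+1, k; rewrite iterSr stepE.
Qed.

Lemma euclid_quotients0 x d : ~ euclid_quotients x 0 d.
Proof.
case=> j [k /=]; have -> : (iter j euclid_step (x, 0%N)).2 = 0%N; last by case.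
by elim: j => //= j ->.
Qed.

Lemma box_gap_euclid_quotients x y d : (0 < y <= x)%N ->
  box_gap x y d <-> euclid_quotients x y d /\ (0 < d)%N.
Proof.
have [m ym] := ubnP y; elim: m x y ym => // m IH x y ym yx.
have y0 : (0 < y)%N by case/andP: yx.
rewrite box_gap_block // euclid_quotients_rec //.
have IH' : (0 < x %% y)%N ->
    box_gap y (x %% y) d <-> euclid_quotients y (x %% y) d /\ (0 < d)%N.
  move=> r0; have ry := ltn_pmod x y0; apply: IH; last by rewrite r0 ltnW.
  exact: leq_trans ry ym.
split.
  case=> [[k kq [dE d0]]|[r0 /IH'[//|E d0]]]; last by split=> //; right.
  by split=> //; left; exists k.
case=> -[[k kq dE]|E] d0; first by left; exists k.
right; have [r0|r0] := posnP (x %% y); first by move: E; rewrite r0 => /euclid_quotients0.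
by split=> //; apply/IH'.
Qed.

Lemma euc_box_gap a b d : (0 < a)%N -> (0 < b)%N ->
  euc a b d /\ d <> 0%N <-> box_gap a b d.
Proof.
move=> a0 b0; rewrite eucE.
have -> : (d <> 0%N) = (0 < d)%N :> Prop by apply/propext; split; lia.
rewrite -box_gap_euclid_quotients; last by lia.
by have [ab|ab] := leqP a b; split=> // /box_gap_sym.
Qed.

(** * The Delta set as the gaps of the lattice of relations *)

Definition relation3 (n1 n2 n3 : nat) (v1 v2 v3 : int) : Prop :=
  (v1 * n1%:Z + v2 * n2%:Z + v3 * n3%:Z = 0)%R.

(** The inequalities say that adding u to the negative part of v gives a
factorization again. *)
Definition lattice_gap (n1 n2 n3 d : nat) : Prop :=
  exists v1 v2 v3 : int,
    [/\ relation3 n1 n2 n3 v1 v2 v3, d = `|(v1 + v2 + v3)%R|%N, (0 < d)%N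
      & forall u1 u2 u3 : int, relation3 n1 n2 n3 u1 u2 u3 ->
          (Num.min v1 0 <= u1)%R -> (Num.min v2 0 <= u2)%R ->
          (Num.min v3 0 <= u3)%R -> ~~ between0 (v1 + v2 + v3)%R (u1 + u2 + u3)%R].

Lemma lattice_gap_swap n1 n2 n3 d :
  lattice_gap n1 n2 n3 d -> lattice_gap n2 n1 n3 d.
Proof.
case=> v1 [v2 [v3 [vn dE d0 H]]]; exists v2, v1, v3; split=> //.
- by move: vn; rewrite /relation3; lia.
- by rewrite dE; lia.
move=> u1 u2 u3 un h1 h2 h3.
rewrite (addrC v2) (addrC u1); apply: H => //.
by move: un; rewrite /relation3; lia.
Qed.

Lemma sum3 (R : pzSemiRingType) (F : 'I_3 -> R) :
  (\sum_(i < 3) F i = F ord0 + F (inord 1) + F (inord 2))%R.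
Proof.
rewrite !big_ord_recl big_ord0 addr0 addrA; congr (_ + F _ + F _)%R;
  by apply: val_inj; rewrite /= inordK.
Qed.

Lemma dot_vec3 (R : pzSemiRingType) (x y z a b c : R) :
  dot (vec3 x y z) (vec3 a b c) = (x * a + y * b + z * c)%R.
Proof. by rewrite /dot sum3 !mxE /= !inordK. Qed.

Lemma len_vec3 (R : pzSemiRingType) (x y z : R) :
  len (vec3 x y z) = (x + y + z)%R.
Proof. by rewrite /len sum3 !mxE /= !inordK. Qed.

Lemma vec3_eta (R : pzSemiRingType) (v : 'rV[R]_3) :
  v = vec3 (v ord0 ord0) (v ord0 (inord 1)) (v ord0 (inord 2)).
Proof.
apply/rowP => i; rewrite !mxE; case: i => -[|[|[|//]]] hi /=; congr (v _ _);
  by apply: val_inj; rewrite /= ?inordK.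
Qed.

Lemma lengthsP n1 n2 n3 s l : lengths (vec3 n1 n2 n3) s l <->
  exists x y z : nat, (x * n1 + y * n2 + z * n3 = s)%N /\ (x + y + z = l)%N.
Proof.
split.
  case=> v; rewrite (vec3_eta _ v) /factorizations /= dot_vec3 len_vec3 => vs <-.
  by exists (v ord0 ord0), (v ord0 (inord 1)), (v ord0 (inord 2)).
case=> x [y [z [xs <-]]]; exists (vec3 x y z); last exact: len_vec3.
by rewrite /factorizations /= dot_vec3.
Qed.

(** From two factorizations with consecutive lengths one takes their difference;
from v one takes the element with factorizations the positive and the negative
parts of v. *)
Lemma delta_set_lattice_gap n1 n2 n3 d :
  delta_set (vec3 n1 n2 n3) d <-> lattice_gap n1 n2 n3 d.
Proof.
split.
  case=> s _ [_ [_ [/lengthsP[x [y [z [zs <-]]]] /lengthsP[x' [y' [z' [z's <-]]]] lt H dE]]].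
  exists (x'%:Z - x%:Z)%R, (y'%:Z - y%:Z)%R, (z'%:Z - z%:Z)%R; split; [|lia|lia|].
    by rewrite /relation3; lia.
  move=> u1 u2 u3 un h1 h2 h3.
  have [w1 e1] : exists w : nat, (x%:Z + u1 = w%:Z)%R by exists `|(x%:Z + u1)%R|%N; lia.
  have [w2 e2] : exists w : nat, (y%:Z + u2 = w%:Z)%R by exists `|(y%:Z + u2)%R|%N; lia.
  have [w3 e3] : exists w : nat, (z%:Z + u3 = w%:Z)%R by exists `|(z%:Z + u3)%R|%N; lia.
  have := H (w1 + w2 + w3)%N; have /[swap]/[apply] : lengths (vec3 n1 n2 n3) s (w1 + w2 + w3)%N.
    apply/lengthsP; exists w1, w2, w3; split=> //.
    suff : (w1%:Z * n1%:Z + w2%:Z * n2%:Z + w3%:Z * n3%:Z = s%:Z)%R by lia.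
    by move: un; rewrite /relation3 -e1 -e2 -e3; lia.
  by rewrite /between0; lia.
case=> v1 [v2 [v3 [vn dE d0 H]]].
pose x := `|(Num.max (- v1) 0)%R|%N; pose x' := `|(Num.max v1 0)%R|%N.
pose y := `|(Num.max (- v2) 0)%R|%N; pose y' := `|(Num.max v2 0)%R|%N.
pose z := `|(Num.max (- v3) 0)%R|%N; pose z' := `|(Num.max v3 0)%R|%N.
have xE : (v1 = x'%:Z - x%:Z)%R by rewrite /x /x'; lia.
have yE : (v2 = y'%:Z - y%:Z)%R by rewrite /y /y'; lia.
have zE : (v3 = z'%:Z - z%:Z)%R by rewrite /z /z'; lia.
have xm : (Num.min v1 0 = - x%:Z)%R by rewrite /x; lia.
have ym : (Num.min v2 0 = - y%:Z)%R by rewrite /y; lia.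
have zm : (Num.min v3 0 = - z%:Z)%R by rewrite /z; lia.
clearbody x x' y y' z z'.
pose s := (x * n1 + y * n2 + z * n3)%N.
have sE : s = (x' * n1 + y' * n2 + z' * n3)%N.
  by move: vn; rewrite /relation3 xE yE zE /s; lia.
have L : lengths (vec3 n1 n2 n3) s (x + y + z) by apply/lengthsP; exists x, y, z.
have L' : lengths (vec3 n1 n2 n3) s (x' + y' + z') by apply/lengthsP; exists x', y', z'.
have M m : lengths (vec3 n1 n2 n3) s m -> ~~ between0 (v1 + v2 + v3)%R (m%:Z - (x + y + z)%:Z)%R.
  case/lengthsP=> a [b [c [abc <-]]].
  have := H (a%:Z - x%:Z)%R (b%:Z - y%:Z)%R (c%:Z - z%:Z)%R.
  rewrite xm ym zm.
  have -> : (a%:Z - x%:Z + (b%:Z - y%:Z) + (c%:Z - z%:Z) = (a + b + c)%:Z - (x + y + z)%:Z)%R by lia.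
  apply; [|lia|lia|lia].
  by rewrite /relation3; move: abc; rewrite /s; lia.
have [x0 [y0 [z0 [s0 _]]]] := (lengthsP _ _ _ _ _).1 L.
exists s; first by exists (vec3 x0 y0 z0); rewrite dot_vec3.
have [lt|lt] := ltnP (x + y + z) (x' + y' + z').
  exists (x + y + z)%N, (x' + y' + z')%N; split=> //; last by lia.
  by move=> m /M; rewrite /between0; lia.
exists (x' + y' + z')%N, (x + y + z)%N; split=> //; [by lia| |by lia].
by move=> m /M; rewrite /between0; lia.
Qed.

(** * Coordinates of the relations *)

(** As a is coprime to the third generator it divides v3, which fixes the
coefficient of v2 = (f, g, -a); what is left is a relation between q and p,
hence a multiple of v1 = (p, -q, 0). *)
Lemma relation3_basis (p q f g a : nat) (v1 v2 v3 : int) :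
  (0 < p)%N -> (0 < a)%N -> coprime p q -> coprime a (f * q + g * p) ->
  relation3 (a * q) (a * p) (f * q + g * p) v1 v2 v3 ->
  exists x y : int, [/\ v1 = y * f%:Z - x * p%:Z, v2 = y * g%:Z + x * q%:Z
                      & v3 = - (y * a%:Z)]%R.
Proof.
move=> p0 a0 pq an3 v0.
have /dvdzP[y yE] : (a%:Z %| v3)%Z.
  have := Gauss_dvdzl v3 (an3 : coprimez a%:Z (f * q + g * p)%N%:Z).
  move=> <-; apply/dvdzP; exists (- (v1 * q%:Z + v2 * p%:Z))%R.
  by move: v0; rewrite /relation3; lia.
have k0 : ((v1 + y * f%:Z) * q%:Z + (v2 + y * g%:Z) * p%:Z = 0)%R.
  have : (a%:Z * ((v1 + y * f%:Z) * q%:Z + (v2 + y * g%:Z) * p%:Z) = 0)%R.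
    by move: v0; rewrite /relation3 yE; lia.
  by move/eqP; rewrite mulf_eq0 => /orP[] /eqP; lia.
have /dvdzP[x xE] : (p%:Z %| (v1 + y * f%:Z)%R)%Z.
  have := Gauss_dvdzl (v1 + y * f%:Z)%R (pq : coprimez p%:Z q%:Z).
  move=> <-; apply/dvdzP; exists (- (v2 + y * g%:Z))%R; lia.
exists (- x)%R, (- y)%R; split; [lia| |lia].
have : (p%:Z * (v2 + y * g%:Z + x * q%:Z) = 0)%R by move: k0; rewrite xE; lia.
by move/eqP; rewrite mulf_eq0 => /orP[] /eqP; lia.
Qed.

(** The condition u >= min(v, 0) for v = y v2 - x v1 and u = y' v2 - x' v1. *)
Definition admissible (p q f g : nat) (x y x' y' : int) : Prop :=
  [/\ Num.min (y * f%:Z - x * p%:Z) 0 <= y' * f%:Z - x' * p%:Z,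
      Num.min (y * g%:Z + x * q%:Z) 0 <= y' * g%:Z + x' * q%:Z
    & y' <= Num.max y 0]%R.

Definition coord_gap (p q f g d1 d2 d : nat) : Prop :=
  exists x y : int,
    [/\ d = `|lin_len d1 d2 x y|%N, (0 < d)%N
      & forall x' y', admissible p q f g x y x' y' ->
          ~~ between0 (lin_len d1 d2 x y) (lin_len d1 d2 x' y')].

(** The common sign [sg] of the two lengths disappears, because replacing all
lengths by their opposites does not affect strict betweenness. *)
Lemma lattice_gap_coord (p q f g a d1 d2 d : nat) (sg : int) :
  (0 < p)%N -> (0 < a)%N -> coprime p q -> coprime a (f * q + g * p) ->
  (sg = 1 \/ sg = -1)%R ->
  (p%:Z - q%:Z = sg * d1%:Z)%R -> (f%:Z + g%:Z - a%:Z = sg * d2%:Z)%R ->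
  lattice_gap (a * q) (a * p) (f * q + g * p) d <-> coord_gap p q f g d1 d2 d.
Proof.
move=> p0 a0 pq an3 sgE l1 l2.
have lenE (x y : int) : ((y * f%:Z - x * p%:Z) + (y * g%:Z + x * q%:Z) + - (y * a%:Z)
                = sg * lin_len d1 d2 x y)%R.
  suff : ((y * f%:Z - x * p%:Z) + (y * g%:Z + x * q%:Z) + - (y * a%:Z)
     = y * (f%:Z + g%:Z - a%:Z) - x * (p%:Z - q%:Z))%R by rewrite l1 l2 /lin_len; lia.
  by lia.
have between0E s t : between0 (sg * s)%R (sg * t)%R = between0 s t.
  by rewrite /between0; case: sgE => ->; lia.
have third (y y' : int) : (Num.min (- (y * a%:Z)) 0 <= - (y' * a%:Z))%R = (y' <= Num.max y 0)%R.
  by rewrite -(mulNr y) -(mulNr y'); nia.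
split.
  case=> v1 [v2 [v3 [v0 dE d0 H]]].
  have [x [y [v1E v2E v3E]]] := relation3_basis _ _ _ _ _ _ _ _ p0 a0 pq an3 v0.
  exists x, y; split=> //.
    by rewrite dE v1E v2E v3E lenE; case: sgE => ->; lia.
  move=> x' y' [h1 h2 h3].
  rewrite -between0E -!lenE -v1E -v2E -v3E.
  apply: H; rewrite ?v1E ?v2E ?v3E ?third //.
  by rewrite /relation3; lia.
case=> x [y [dE d0 H]].
exists (y * f%:Z - x * p%:Z)%R, (y * g%:Z + x * q%:Z)%R, (- (y * a%:Z))%R; split.
- by rewrite /relation3; lia.
- by rewrite dE lenE; case: sgE => ->; lia.
- by [].
move=> u1 u2 u3 u0.
have [x' [y' [-> -> ->]]] := relation3_basis _ _ _ _ _ _ _ _ p0 a0 pq an3 u0.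
rewrite third => h1 h2 h3; rewrite !lenE between0E; exact: H.
Qed.

Lemma between0_sub s t : between0 s (s - t)%R = between0 s t.
Proof. by rewrite /between0; lia. Qed.

Lemma lin_len_sub a b x y x' y' :
  lin_len a b (x - x')%R (y - y')%R = (lin_len a b x y - lin_len a b x' y')%R.
Proof. by rewrite /lin_len; lia. Qed.

(** The translation by v sends the relations u >= min(-v, 0) to those with
u + v >= min(v, 0), so v and -v are gaps together. *)
Lemma coord_gap_ge0 p q f g d1 d2 d : coord_gap p q f g d1 d2 d ->
  exists (x : int) (y : nat),
    [/\ d = `|lin_len d1 d2 x y|%N, (0 < d)%N
      & forall x' y', admissible p q f g x y x' y' ->
          ~~ between0 (lin_len d1 d2 x y) (lin_len d1 d2 x' y')].
Proof.
case=> x [y [dE d0 H]].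
have [y0|y0] := leP 0%R y.
  by exists x, `|y|%N; have -> : (`|y|%N%:Z = y)%R by lia.
exists (- x)%R, `|y|%N; have -> : (`|y|%N%:Z = - y)%R by lia.
have linN : lin_len d1 d2 (- x) (- y)%R = (- lin_len d1 d2 x y)%R by rewrite /lin_len; lia.
split=> //; first by rewrite linN; lia.
move=> x' y' [h1 h2 h3].
have := H (x' + x)%R (y' + y)%R.
have -> : lin_len d1 d2 (x' + x) (y' + y)%R = (lin_len d1 d2 x' y' + lin_len d1 d2 x y)%R.
  by rewrite /lin_len; lia.
have /[swap]/[apply] : admissible p q f g x y (x' + x)%R (y' + y)%R.
  by split; [move: h1|move: h2|move: h3]; rewrite ?mulrDl; lia.
by rewrite linN /between0; lia.
Qed.

(** When x and y do not both have the sign of an interesting gap, that is when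
y = 0 or x <= 0, comparison with v1 or v2 shows that d is d1 or d2.  Otherwise
(x, y) itself is a box gap: if (x', y') violates the first inequality of
[admissible], then (x - x', y - y') satisfies it. *)
Lemma coord_gap_box p q f g d1 d2 d : (0 < p)%N -> (0 < d1)%N -> (0 < d2)%N ->
  coord_gap p q f g d1 d2 d -> box_gap d1 d2 d.
Proof.
move=> p0 d10 d20 /coord_gap_ge0[x [[|y] [dE d0 H]]].
  have -> : d = d1; last exact: box_gap_left.
  have x0 : (x != 0)%R by apply/eqP => xE; move: d0; rewrite dE xE /lin_len; lia.
  have [x1|x1] := leP 1%R x.
    have := H 1%R 0%R; have /[swap]/[apply] : admissible p q f g x 0%N 1%R 0%R.
      by split; rewrite ?mul0r; nia.
    by have := ler_wpM2r (isT : (0 <= d1%:Z)%R) x1; rewrite dE /between0 /lin_len; lia.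
  have xN1 : (x <= -1)%R by lia.
  have := H (-1)%R 0%R; have /[swap]/[apply] : admissible p q f g x 0%N (-1)%R 0%R.
    by split; rewrite ?mul0r; nia.
  by have := ler_wpM2r (isT : (0 <= d1%:Z)%R) xN1; rewrite dE /between0 /lin_len; lia.
have [x0|x0] := leP x 0%R.
  have -> : d = d2; last by apply: box_gap_sym; apply: box_gap_left.
  have := H 0%R 1%R; have /[swap]/[apply] : admissible p q f g x y.+1 0%R 1%R.
    by split; nia.
  by move: dE d0; rewrite /between0 /lin_len; nia.
exists `|x|%N, y.+1; have xE : (`|x|%N%:Z = x)%R by lia.
split=> //; rewrite xE // => x' y' hx hy.
set x1 := x'%:Z%R; set y1 := y'%:Z%R.
have hx1 : (0 <= x1 <= x)%R by rewrite /x1; lia.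
have hy1 : (0 <= y1 <= y.+1%:Z)%R by rewrite /y1; lia.
have [le|lt] := leP (Num.min (y.+1%:Z * f%:Z - x * p%:Z) 0)%R (y1 * f%:Z - x1 * p%:Z)%R.
  by apply: H; split=> //; nia.
rewrite -between0_sub -lin_len_sub; apply: H; split; first by lia.
  by nia.
by lia.
Qed.

(** The two numerical hypotheses are the minimality of |len v2|, used when
v2 - v1 has nonnegative first two coordinates, and the suitable order of the
generators, used when v2 has zero second coordinate: then the multiples of -v2
can be admissible unless p < f. *)
Lemma box_gap_coord p q f g d1 d2 d :
  (0 < p)%N -> (0 < q)%N -> (0 < d1)%N -> (0 < d2)%N ->
  ((p <= f -> d2.*2 <= d1)%N) -> (g = 0%N -> (p < f)%N) ->
  box_gap d1 d2 d -> coord_gap p q f g d1 d2 d.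
Proof.
move=> p0 q0 d10 d20 minh suit [x [y [dE d0 H]]]; exists x, y; split=> //.
have H1 : (0 < x)%N -> ~~ between0 (lin_len d1 d2 x y) (- d1%:Z)%R.
  by move=> x0; have := H 1%N 0%N x0 (leq0n y); rewrite {2}/lin_len; congr (~~ between0 _ _); lia.
have H2 : (0 < y)%N -> ~~ between0 (lin_len d1 d2 x y) d2%:Z%R.
  by move=> y0; have := H 0%N 1%N (leq0n x) y0; rewrite {2}/lin_len; congr (~~ between0 _ _); lia.
have Hbox (x' y' : int) : (0 <= x' <= x%:Z)%R -> (0 <= y' <= y%:Z)%R ->
    ~~ between0 (lin_len d1 d2 x y) (lin_len d1 d2 x' y').
  move=> hx hy; have := H `|x'|%N `|y'|%N.
  have -> : (`|x'|%N%:Z = x')%R by lia.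
  have -> : (`|y'|%N%:Z = y')%R by lia.
  by apply; lia.
move=> x' y' [h1 h2 h3].
have y'y : (y' <= y%:Z)%R by lia.
have h2' : (0 <= y' * g%:Z + x' * q%:Z)%R by nia.
have [x'0|x'0] := ltP x' 0%R.
  have y'0 : (0 < y')%R.
    rewrite ltNge; apply/negP => y'0.
    have := mulr_le0_ge0 y'0 (isT : (0 <= g%:Z)%R).
    by have : (x' * q%:Z < 0)%R; [nia | lia].
  have : (d2%:Z <= lin_len d1 d2 x' y')%R by rewrite /lin_len; nia.
  have y0 : (0 < y)%N by lia.
  by have := H2 y0; rewrite /between0; lia.
(* The two cases are the two possible signs of the first coordinate of
   y v2 - x v1, which changes the meaning of the first constraint. *)
have [A|B] := leqP (y * f) (x * p).
  have h1' : (y%:Z * f%:Z - y' * f%:Z <= x%:Z * p%:Z - x' * p%:Z)%R by lia.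
  have x'x : (x' <= x%:Z)%R by nia.
  have [y'0|y'0] := ltP y' 0%R; last by apply: Hbox; apply/andP; split.
  have [x'1|x'1] := ltP 0%R x'.
    have x0 : (0 < x)%N by lia.
    have : (lin_len d1 d2 x' y' <= - d1%:Z)%R by rewrite /lin_len; nia.
    by have := H1 x0; rewrite /between0; lia.
  (* Here u is a multiple of -v2, which forces g = 0 and hence x >= y + 2. *)
  have x'E : x' = 0%R by lia.
  have g0 : g = 0%N by move: h2'; rewrite x'E; nia.
  have pf := suit g0; have d21 := minh (ltnW pf).
  have xy : (y.+2 <= x)%N.
    rewrite ltnNge; apply/negP => xy.
    have : (x * p <= y.+1 * p)%N by rewrite leq_mul2r xy orbT.
    have : (y.+1 * p < y.+1 * f)%N by rewrite ltn_mul2l pf.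
    have : (f%:Z <= - y' * f%:Z)%R by nia.
    by move: h1'; rewrite x'E; lia.
  have x0 : (0 < x)%N by lia.
  have L : (lin_len d1 d2 x y < - d1%:Z)%R by rewrite /lin_len; nia.
  by have := H1 x0; rewrite /between0; lia.
have h1' : (x' * p%:Z <= y' * f%:Z)%R by lia.
have f0 : (0 < f)%N by case: f B {minh suit h1 h1'} => //; lia.
have y0 : (0 < y)%N by lia.
have y'0 : (0 <= y')%R by nia.
(* Beyond the right side of the box the length is at most L - d1 where L is
   the length of v; with L <= d2 this is harmless if d2 <= d1, and if d1 < d2
   then f < p makes the position impossible. *)
have [x'x|x'x] := leP x' x%:Z%R; first by apply: Hbox; apply/andP; split.
have L' : (lin_len d1 d2 x' y' <= lin_len d1 d2 x y - d1%:Z)%R.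
  have := ler_wpM2r (isT : (0 <= d2%:Z)%R) y'y.
  have x'x1 : (x%:Z + 1 <= x')%R by lia.
  by have := ler_wpM2r (isT : (0 <= d1%:Z)%R) x'x1; rewrite /lin_len; lia.
have := H2 y0.
have [d21|d12] := leqP d2 d1; first by rewrite /between0; lia.
have fp : (f < p)%N by rewrite ltnNge; apply/negP => /minh; lia.
have xy : (x < y)%N by nia.
have [x0|x0] := posnP x; last first.
  suff : (d2%:Z < lin_len d1 d2 x y)%R by rewrite /between0; lia.
  have : (y%:Z * d2%:Z >= (x%:Z + 1) * d2%:Z)%R by apply: ler_wpM2r; lia.
  by have : (0 < x%:Z * (d2%:Z - d1%:Z))%R; [apply: mulr_gt0; lia | rewrite /lin_len; lia].
have [y1|y1] := leqP y 1; last by rewrite x0 /between0 /lin_len; nia.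
have : (y' * f%:Z <= f%:Z)%R by apply: ler_piMl; lia.
have : (p%:Z <= x' * p%:Z)%R by apply: ler_peMl; lia.
lia.
Qed.

(** * The two types of symmetric semigroups *)

Lemma lattice_gap_euc (p q f g a d1 d2 d : nat) (sg : int) :
  (0 < p)%N -> (0 < q)%N -> (0 < a)%N ->
  coprime p q -> coprime a (f * q + g * p) ->
  (sg = 1 \/ sg = -1)%R ->
  (p%:Z - q%:Z = sg * d1%:Z)%R -> (f%:Z + g%:Z - a%:Z = sg * d2%:Z)%R ->
  (0 < d1)%N -> (0 < d2)%N ->
  ((p <= f -> d2.*2 <= d1)%N) -> (g = 0%N -> (p < f)%N) ->
  lattice_gap (a * q) (a * p) (f * q + g * p) d <-> euc d1 d2 d /\ d <> 0%N.
Proof.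
move=> p0 q0 a0 pq an3 sgE l1 l2 d10 d20 minh suit.
rewrite euc_box_gap // (lattice_gap_coord _ _ _ _ _ d1 d2 _ sg) //.
by split; [exact: coord_gap_box | exact: box_gap_coord].
Qed.

Lemma le_divz (x : int) (b m : nat) : (0 < m)%N ->
  (x <= (b %/ m)%N%:Z)%R = (x * m%:Z <= b%:Z)%R.
Proof.
move=> m0; case: x => x; last first.
  by have -> : (Negz x * m%:Z <= b%:Z)%R by rewrite NegzE mulNr; lia.
by rewrite -PoszM !lez_nat leq_divRL.
Qed.

Lemma lambda_rangeP (m1 m2 b c : nat) (lam : int) : (0 < m1)%N -> (0 < m2)%N ->
  lambda_range m1 m2 b c lam <->
  (0 <= b%:Z + lam * m2%:Z)%R /\ (0 <= c%:Z - lam * m1%:Z)%R.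
Proof.
move=> m10 m20; rewrite /lambda_range /= lerNl !le_divz //.
by split=> [/andP[]|[h1 h2]]; [|apply/andP]; split; lia.
Qed.

(** This is the parametrization with p = s1, q = s2, f = 0, g = s2, a = s3. *)
Lemma one_betti_lattice_gap (s1 s2 s3 d1 d2 d : nat) :
  (0 < s3 < s2)%N -> (s2 < s1)%N ->
  coprime s1 s2 -> coprime s1 s3 -> coprime s2 s3 ->
  d1 = (s1 - s2)%N -> d2 = (s2 - s3)%N ->
  lattice_gap (s2 * s3) (s1 * s3) (s1 * s2) d <-> euc d1 d2 d /\ d <> 0%N.
Proof.
move=> /andP[s30 s32] s21 c12 c13 c23 d1E d2E.
have := lattice_gap_euc s1 s2 0 s2 s3 d1 d2 d 1%R.
rewrite mul0n add0n (mulnC s3 s2) (mulnC s3 s1) (mulnC s2 s1); apply; try lia.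
by rewrite coprimeMr ![coprime s3 _]coprime_sym c13 c23.
Qed.

(** The first two generators are exchanged when len v2 < 0; v1 then becomes
(m1, -m2, 0), which has negative length as well. *)
Lemma two_betti_lattice_gap (m1 m2 a b c d1 d2 d : nat) (lam : int) :
  (0 < m1 < m2)%N -> coprime m1 m2 -> (0 < a)%N ->
  coprime a (b * m1 + c * m2) -> suitable_order
    (vec3 (a * m1) (a * m2) (b * m1 + c * m2))%N m1 m2 a b c ->
  lambda_range m1 m2 b c lam ->
  (forall mu : int, lambda_range m1 m2 b c mu ->
     (`|len (second_vector m1 m2 a b c lam)|
        <= `|len (second_vector m1 m2 a b c mu)|)%R) ->
  d1 = (m2 - m1)%N -> (d2%:Z = `|len (second_vector m1 m2 a b c lam)|)%R ->
  (0 < d2)%N ->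
  lattice_gap (a * m1) (a * m2) (b * m1 + c * m2) d <-> euc d1 d2 d /\ d <> 0%N.
Proof.
move=> /andP[m10 m12] cm a0 ca suit; have m20 : (0 < m2)%N by lia.
move=> /lambda_rangeP-/(_ m10 m20)[b0 c0] minh d1E d2E d20.
have lenE mu : len (second_vector m1 m2 a b c mu)
    = ((b%:Z + mu * m2%:Z) + (c%:Z - mu * m1%:Z) - a%:Z)%R by rewrite len_vec3.
have [b' b'E] : exists b' : nat, (b%:Z + lam * m2%:Z = b'%:Z)%R.
  by exists `|(b%:Z + lam * m2%:Z)%R|%N; lia.
have [c' c'E] : exists c' : nat, (c%:Z - lam * m1%:Z = c'%:Z)%R.
  by exists `|(c%:Z - lam * m1%:Z)%R|%N; lia.
have n3E : (b * m1 + c * m2 = b' * m1 + c' * m2)%N.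
  suff : (b%:Z * m1%:Z + c%:Z * m2%:Z = b'%:Z * m1%:Z + c'%:Z * m2%:Z)%R by lia.
  by rewrite -b'E -c'E; lia.
have mu_min (mu : int) : (0 <= b%:Z + mu * m2%:Z)%R -> (0 <= c%:Z - mu * m1%:Z)%R ->
    (d2%:Z <= `|b'%:Z + c'%:Z - a%:Z + (mu - lam) * d1%:Z|)%R.
  move=> h1 h2; have := minh mu ((lambda_rangeP _ _ _ _ _ m10 m20).2 (conj h1 h2)).
  rewrite -d2E lenE -b'E -c'E d1E -subzn ?(ltnW m12) //.
  by congr (_ <= `|_|)%R; lia.
have := d2E; rewrite lenE b'E c'E => d2E'.
(* If the second coordinate of v2 vanished with b' <= m2, then a m1 m2 - a n3
   would be a multiple of a m1, against the suitable order; symmetrically after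
   the exchange of the generators. *)
have suit_gen u v : (a * m1 * m2 = a * (b * m1 + c * m2) + u * (a * m1) + v * (a * m2))%N -> False.
  move=> E; apply: suit; exists (u * (a * m1) + v * (a * m2))%N; last by lia.
  by exists (vec3 u v 0%N); rewrite dot_vec3 /=; lia.
rewrite n3E in ca suit_gen *.
have [l0|l0] := leP 0%R (b'%:Z + c'%:Z - a%:Z)%R.
  apply: (lattice_gap_euc m2 m1 b' c' a d1 d2 d 1%R) => //; try lia.
  - by rewrite coprime_sym.
  - move=> le; have := mu_min (lam - 1)%R; have -> : (lam - 1 - lam = -1)%R by lia.
    by move=> H; have := H _ _; lia.
  move=> c'0; rewrite ltnNge; apply/negP => le.
  apply: (suit_gen (m2 - b')%N 0%N); rewrite c'0.
  by have [e ->] : exists e, m2 = (b' + e)%N; [exists (m2 - b')%N; lia | rewrite addKn; lia].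
rewrite (addnC (b' * m1)); rewrite addnC in ca.
have -> : lattice_gap (a * m1) (a * m2) (c' * m2 + b' * m1) d
       = lattice_gap (a * m2) (a * m1) (c' * m2 + b' * m1) d.
  by apply/propext; split; apply: lattice_gap_swap.
apply: (lattice_gap_euc m1 m2 c' b' a d1 d2 d (-1)%R) => //; try lia.
- move=> le; have := mu_min (lam + 1)%R; have -> : (lam + 1 - lam = 1)%R by lia.
  by move=> H; have := H _ _; lia.
move=> b'0; rewrite ltnNge; apply/negP => le.
apply: (suit_gen 0%N (m1 - c')%N); rewrite b'0.
by have [e ->] : exists e, m1 = (c' + e)%N; [exists (m1 - c')%N; lia | rewrite addKn; lia].
Qed.

Theorem theorem19 (n : 'rV[nat]_3)
    (hgcd : \big[gcdn/0%N]_(i < 3) n ord0 i = 1%N)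
    (hmin : minimally_generated n)
    (hsym : symmetric_semigroup (semigroup n))
    (v1 v2 : 'rV[int]_3) (hv : chosen_basis n v1 v2)
    (d1 d2 : nat) (hd1 : (d1%:Z = len v1)%R) (hd2 : (d2%:Z = `|len v2|)%R)
    (d1_gt0 : (0 < d1)%N) (d2_gt0 : (0 < d2)%N) :
  delta_set n = euc d1 d2 `\ 0%N.
Proof.
apply/seteqP; suff H d : delta_set n d <-> euc d1 d2 d /\ d <> 0%N.
  by split=> d /H.
case: hv => -[_].
  case=> s1 [s2 [s3 [[s32 s21] [c12 c13 c23] nE v1E v2E]]].
  rewrite nE delta_set_lattice_gap.
  by apply: one_betti_lattice_gap => //; move: hd1 hd2; rewrite v1E v2E !len_vec3; lia.
case=> m1 [m2 [a [b [c [[m12 cm a2 _ ca] nE suit v1E [lam [lamr minh v2E]]]]]]].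
rewrite nE delta_set_lattice_gap.
apply: (two_betti_lattice_gap _ _ _ _ _ _ _ _ lam) => //; try lia.
- by rewrite -nE.
- by move: hd1; rewrite v1E len_vec3; lia.
- by rewrite hd2 v2E.
Qed.
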